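(* If $G$ is a compactly generated locally compact group, then $N_{\mathrm{Tr}}(G)=N_{\mathrm{SIN}}(G)$.
   Context: For a locally compact group $G$, $\mathrm{T}(G)$ is the set of continuous positive definite functions $u:G\to\mathbb{C}$ with $u(e)=1$ and $u(st)=u(ts)$ for all $s,t\in G$. For $u\in\mathrm{T}(G)$ let $N_u=u^{-1}(\{1\})$ (a closed normal subgroup), and let $N_{\mathrm{Tr}}(G)=\bigcap_{u\in \mathrm{T}(G)}N_u$. $[\mathrm{SIN}]$ is the class of locally compact groups having a neighbourhood base at the identity of conjugation-invariant neighbourhoods, and $N_{\mathrm{SIN}}(G)$ is the intersection of all closed normal subgroups $N$ of $G$ with $G/N\in[\mathrm{SIN}]$. *)

(* Defs.v *)
From HB Require Import structures.
From mathcomp Require Import all_boot all_order all_algebra.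
From mathcomp Require Import all_classical all_reals all_analysis.
From mathcomp Require Import complex.

Set Implicit Arguments.
Unset Strict Implicit.
Unset Printing Implicit Defensive.

Import Order.TTheory GRing.Theory Num.Theory.
Import numFieldNormedType.Exports.

Local Open Scope classical_set_scope.
Local Open Scope group_scope.

HB.mixin Record isTopologicalGroup G & Topological G & Group G := {
  mulg_continuous : continuous (fun p : G * G => p.1 * p.2 : G);
  invg_continuous : continuous (fun x : G => x^-1 : G)
}.

#[short(type="topGroupType")]
HB.structure Definition TopologicalGroup :=
  {G of Topological G & Group G & isTopologicalGroup G}.

Definition subgroup (G : groupType) (H : set G) : Prop :=
  [/\ H 1, forall x y, H x -> H y -> H (x * y) & forall x, H x -> H x^-1].

Record normalSubgroup (G : groupType) := NormalSubgroup {
  normal_set :> set G;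
  normal_subgroup : subgroup normal_set;
  normal_conj : forall x y, normal_set x -> normal_set (x ^ y)
}.

Section Quotient.
Variables (G : topGroupType) (N : normalSubgroup G).
Local Open Scope quotient_scope.

(* [coset_rel x y] means xN = yN. *)
Definition coset_rel : rel G := fun x y => `[< normal_set N (x^-1 * y) >].

Lemma coset_rel_refl : reflexive coset_rel.
Proof.
by move=> x; apply/asboolP; rewrite mulVg; case: (normal_subgroup N).
Qed.

Lemma coset_rel_sym : symmetric coset_rel.
Proof.
suff h x y : coset_rel x y -> coset_rel y x by move=> x y; apply/idP/idP; exact: h.
move=> /asboolP Nxy; apply/asboolP; case: (normal_subgroup N) => _ _ NV.
by have := NV _ Nxy; rewrite invgM invgK.
Qed.

Lemma coset_rel_trans : transitive coset_rel.
Proof.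
move=> y x z /asboolP Nxy /asboolP Nyz; apply/asboolP.
case: (normal_subgroup N) => _ NM _.
by have := NM _ _ Nxy Nyz; rewrite mulgA mulgK.
Qed.

Definition coset_equiv :=
  EquivRel coset_rel coset_rel_refl coset_rel_sym coset_rel_trans.

Definition quotient_group : Type := quotient_topology {eq_quot coset_equiv}.
Local Notation Q := quotient_group.

HB.instance Definition _ := Topological.on Q.
HB.instance Definition _ := Quotient.on Q.

Lemma quot_eqP (x y : G) : \pi_Q x = \pi_Q y <-> normal_set N (x^-1 * y).
Proof.
by split=> [/eqmodP/asboolP //|Nxy]; apply/eqmodP/asboolP.
Qed.

Definition quot_mul (a b : Q) : Q := \pi_Q (repr a * repr b).
Definition quot_one : Q := \pi_Q 1.
Definition quot_inv (a : Q) : Q := \pi_Q (repr a)^-1.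

Lemma quot_mulE (x y : G) : quot_mul (\pi_Q x) (\pi_Q y) = \pi_Q (x * y).
Proof.
apply/quot_eqP; case: (normal_subgroup N) => _ NM _.
have /quot_eqP hx : \pi_Q (repr (\pi_Q x)) = \pi_Q x by rewrite reprK.
have /quot_eqP hy : \pi_Q (repr (\pi_Q y)) = \pi_Q y by rewrite reprK.
have := NM _ _ (normal_conj (repr (\pi_Q y)) hx) hy.
by rewrite conjgE invgM !mulgA mulgK.
Qed.

Lemma quot_invE (x : G) : quot_inv (\pi_Q x) = \pi_Q x^-1.
Proof.
apply/quot_eqP; case: (normal_subgroup N) => _ _ NV.
have /quot_eqP hx : \pi_Q x = \pi_Q (repr (\pi_Q x)) by rewrite reprK.
have := normal_conj x^-1 hx.
by rewrite conjgE !invgK !mulgA mulgV mul1g.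
Qed.

Lemma quot_pi_surj (a : Q) : exists x : G, a = \pi_Q x.
Proof. by exists (repr a); rewrite reprK. Qed.

Lemma quot_mulA : associative quot_mul.
Proof.
move=> a b c; have [x ->] := quot_pi_surj a.
have [y ->] := quot_pi_surj b; have [z ->] := quot_pi_surj c.
by rewrite (quot_mulE x y) (quot_mulE y z) (quot_mulE (x * y)) quot_mulE mulgA.
Qed.

Lemma quot_mul1 : left_id quot_one quot_mul.
Proof. by move=> a; have [x ->] := quot_pi_surj a; rewrite quot_mulE mul1g. Qed.

Lemma quot_mulr1 : right_id quot_one quot_mul.
Proof. by move=> a; have [x ->] := quot_pi_surj a; rewrite quot_mulE mulg1. Qed.

Lemma quot_mulV : left_inverse quot_one quot_inv quot_mul.
Proof.
move=> a; have [x ->] := quot_pi_surj a.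
by rewrite (quot_invE x) (quot_mulE x^-1 x) mulVg.
Qed.

Lemma quot_mulrV : right_inverse quot_one quot_inv quot_mul.
Proof.
move=> a; have [x ->] := quot_pi_surj a.
by rewrite (quot_invE x) (quot_mulE x x^-1) mulgV.
Qed.

HB.instance Definition _ :=
  isGroup.Build Q quot_mulA quot_mul1 quot_mulr1 quot_mulV quot_mulrV.

Lemma quot_pi_continuous : continuous (\pi_Q : G -> Q).
Proof. exact: (@pi_continuous G {eq_quot coset_equiv}). Qed.

Lemma mulgr_continuous (z : G) : continuous (fun x : G => x * z).
Proof.
move=> x; apply: (@continuous_comp _ _ _ (fun x => (x, z))
  (fun p : G * G => p.1 * p.2)); last exact: mulg_continuous.
by apply: cvg_pair => /=; [exact: cvg_id|exact: cvg_cst].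
Qed.

Lemma quot_pi_open (U : set G) : open U -> open ((\pi_Q : G -> Q) @` U).
Proof.
move=> oU.
suff -> : (\pi_Q : G -> Q) @` U =
    (\pi_Q : G -> Q) @` (\bigcup_(z in N) ((fun x => x * z) @^-1` U)).
  rewrite [X in X _]/open/= /quotient_open.
  rewrite (_ : _ @^-1` _ = \bigcup_(z in N) ((fun x => x * z) @^-1` U)).
    apply: bigcup_open => z _; apply: open_comp => // x _.
    exact: mulgr_continuous.
  apply/seteqP; split => [x [y [z Nz /= Uyz]] /quot_eqP Nyx|x h]; last by exists x.
  case: (normal_subgroup N) => _ NM NV.
  exists (x^-1 * y * z); last by rewrite /= -!mulgA mulVKg.
  by apply: NM => //; have := NV _ Nyx; rewrite invgM invgK.
apply/seteqP; split => [_ [x Ux <-]|_ [x [z Nz /= Uxz] <-]].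
  exists x => //; exists 1; last by rewrite /= mulg1.
  by case: (normal_subgroup N).
exists (x * z) => //; apply/quot_eqP; rewrite invgM -mulgA mulVg mulg1.
by case: (normal_subgroup N) => _ _; exact.
Qed.

Lemma quot_mul_continuous : continuous (fun p : Q * Q => p.1 * p.2 : Q).
Proof.
move=> [a b] W /=; have [x ->] := quot_pi_surj a; have [y ->] := quot_pi_surj b.
rewrite -[_ * _]/(quot_mul _ _) quot_mulE => nW.
have := @mulg_continuous G (x, y) _ (quot_pi_continuous nW).
case=> -[A B] [/= nA nB] AB.
move: nA nB; rewrite {1}nbhsE {1}[nbhs y]nbhsE => -[A' [oA' A'x] sA] [B' [oB' B'y] sB].
suff : filter_prod (nbhs (\pi_Q x : Q)) (nbhs (\pi_Q y : Q))
    ((fun p : Q * Q => p.1 * p.2 : Q) @^-1` W) by exact.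
exists ((\pi_Q : G -> Q) @` A', (\pi_Q : G -> Q) @` B').
  split; apply: open_nbhs_nbhs; split=> /=; [|by exists x| |by exists y].
  - exact: quot_pi_open.
  - exact: quot_pi_open.
move=> [_ _] [/= [x' A'x' <-] [y' B'y' <-]].
rewrite -[_ * _]/(quot_mul _ _) quot_mulE.
by apply: (AB (x', y')); split; [exact: sA|exact: sB].
Qed.

Lemma quot_inv_continuous : continuous (fun a : Q => a^-1 : Q).
Proof.
apply/(@quotient_continuous G {eq_quot coset_equiv}).
rewrite (_ : _ \o _ = \pi_Q \o (fun x : G => x^-1)); last first.
  by apply/funext => x /=; rewrite -[LHS]/(quot_inv _) quot_invE.
move=> x; apply: continuous_comp; [exact: invg_continuous|].
exact: quot_pi_continuous.
Qed.

HB.instance Definition _ :=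
  isTopologicalGroup.Build Q quot_mul_continuous quot_inv_continuous.

End Quotient.

(* As usual in harmonic analysis, locally compact groups are Hausdorff. *)
Definition lc_group (G : topGroupType) : Prop :=
  hausdorff_space G /\ locally_compact [set: G].

Definition compactly_generated (G : topGroupType) : Prop :=
  exists2 K : set G, compact K & smallest (@subgroup G) K = [set: G].

Definition SIN (G : topGroupType) : Prop :=
  lc_group G /\
  forall U : set G, nbhs 1 U ->
    exists V : set G, [/\ nbhs 1 V, V `<=` U & forall x y, V x -> V (x ^ y)].

Definition N_SIN (G : topGroupType) : set G :=
  \bigcap_(N in [set N : normalSubgroup G | closed N /\ SIN (quotient_group N)])
    (N : set G).

Arguments N_SIN G : clear implicits.

Section Traces.
Variables (R : realType) (G : topGroupType).
Local Open Scope ring_scope.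

(* In R[i], [0 <= z] means that z is real and nonnegative. *)
Definition positive_definite (u : G -> R[i]) : Prop :=
  forall (n : nat) (c : 'I_n -> R[i]) (s : 'I_n -> G),
    0 <= \sum_(i < n) \sum_(j < n) conjc (c i) * c j * u ((s i)^-1 * s j)%g.

(* The alias [R[i]^o] carries the topology given by the complex modulus. *)
Definition traces : set (G -> R[i]) :=
  [set u : G -> R[i] |
    [/\ continuous (u : G -> R[i]^o), positive_definite u, u 1%g = 1
      & forall s t : G, u (s * t)%g = u (t * s)%g]].

Definition trace_kernel (u : G -> R[i]) : set G := u @^-1` [set 1].

Definition N_Tr : set G := \bigcap_(u in traces) trace_kernel u.

End Traces.
Arguments N_Tr R G : clear implicits.

(* Main.v *)
Require Import Defs.
From mathcomp Require Import all_boot all_order all_algebra.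
From mathcomp Require Import all_classical all_reals all_analysis.
From mathcomp Require Import complex.
From mathcomp Require Import ring lra.

Set Implicit Arguments.
Unset Strict Implicit.
Unset Printing Implicit Defensive.

Import Order.TTheory GRing.Theory Num.Theory.
Import numFieldNormedType.Exports.

Local Open Scope classical_set_scope.
Local Open Scope ring_scope.

(** Why the two kernels agree.

    A trace [u] gives the continuous conjugation-invariant function
    [x |-> u x] which, on the quotient of [G] by the kernel of [u], takes the
    value 1 only at the identity.  So [N_SIN] lies in [N_Tr] once a compactly
    generated locally compact group carrying such a function is known to be
    SIN ([faithful_trace_SIN]).  Take a compact neighbourhood [A] of 1, a
    compact symmetric generating set [K] and a neighbourhood [U] of 1.  The
    conjugates of [A] by [K] that fall outside the interior of the
    intersection of [A] and [U] form a compact set missing 1, so [u] maps it to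
    a compact set missing the number 1.  The points of the intersection of [A]
    and [U] at which [u] avoids that set are therefore stable under conjugation
    by [K], hence by the whole group.

    Conversely [N_Tr] lies in [N_SIN] because continuous traces separate the
    points of a locally compact SIN group from the identity
    ([SIN_trace_separates]).  The trace is the autocorrelation
    [s |-> I (fun x => f x * f (s^-1 * x))] of a conjugation-invariant bump
    function [f] supported near 1, where [I] is a Haar integral normalised by
    [I (f ^+ 2) = 1]; it is positive definite because its Gram sums are
    integrals of squares, and it vanishes at [a] when the support of [f] and its
    translate by [a] are disjoint.

    The bump function is obtained by the Birkhoff-Kakutani chain construction
    applied to conjugation-invariant neighbourhoods ([invariant_bump]).  The
    integral is the limit, along an ultrafilter of shrinking neighbourhoods [W]
    of 1, of the ratios of Weil's covering numbers [(g : W) / (f ^+ 2 : W)].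
    Covering numbers are subadditive, and asymptotically superadditive on
    uniformly continuous functions ([covering_number_superadditive]).  When the
    sets [W] are conjugation-invariant the covering numbers are unchanged by
    left translations and by conjugations alike, and so is their limit; this
    makes the autocorrelation a class function. *)

(** * Positive definite functions and the kernel of a trace *)

Section PositiveDefinite.
Variables (R : realType) (G : topGroupType) (u : G -> R[i]).
Hypotheses (upd : positive_definite u) (u1 : u 1%g = 1).

(** With coefficients [1] and [b] on the points [1] and [x], the Hermitian sum is
    real for [b = 1] and for [b = 'i]; the two imaginary parts compare [u x^-1]
    with the conjugate of [u x]. *)
Lemma posdef_inv x : u x^-1%g = conjc (u x).
Proof.
pose s (i : 'I_2) := nth 1%g [:: 1%g; x] i.
have h b := upd (fun i : 'I_2 => nth 0 [:: 1; b] i) s.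
have := h 1; have := h 'i%C.
rewrite !big_ord_recl !big_ord0 /s /= invg1 !mul1g mulg1 mulVg u1.
case: (u x) => p q; case: (u x^-1%g) => r t.
rewrite /GRing.mul /GRing.add/= !lecE/= => /andP[/eqP e1 _] /andP[/eqP e2 _].
by congr (_ +i* _)%C; lra.
Qed.

(** The Cauchy-Schwarz inequality for the kernel [u (s^-1 * t)]: the combination
    of the points [1] and [x^-1] with coefficients [t] and [- t] has norm 0, so
    it pairs to 0 with the point [y], for every [t]. *)
Lemma posdef_mul_kernel x y : u x = 1 -> u (x * y)%g = u y.
Proof.
move=> ux; have uxV : u x^-1%g = 1 by rewrite posdef_inv ux; congr (_ +i* _)%C; rewrite oppr0.
pose s (i : 'I_3) := nth 1%g [:: 1%g; x^-1%g; y] i.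
have h t := upd (fun i : 'I_3 => nth 0 [:: t; - t; 1] i) s.
have uyV : u y^-1%g = conjc (u y) by exact: posdef_inv.
have uyxV : u (y^-1 * x^-1)%g = conjc (u (x * y)%g) by rewrite -invgM posdef_inv.
apply/eqP; rewrite -subr_eq0; apply/eqP.
case eD: (u (x * y)%g - u y) => [p q].
have uxy : u (x * y)%g = u y + (p +i* q)%C by rewrite -eD addrC subrK.
have {}h a b : 0 <= 1 - 2 * (a * p + b * q).
  have := h (a +i* b)%C.
  rewrite !big_ord_recl !big_ord0 /s /= !invg1 !invgK !mul1g !mulg1 !mulVg !mulgV.
  rewrite u1 ux uxV uyV uyxV uxy; case: (u y) => r t.
  rewrite lecE => /andP[_] /= hr.
  by lra.
(* The coefficient t that would make the real expression equal to -1. *)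
have pq : p * p + q * q = 0.
  apply/eqP/negPn/negP => n0.
  have := h (p / (p * p + q * q)) (q / (p * p + q * q)).
  have -> : p / (p * p + q * q) * p + q / (p * p + q * q) * q = 1 by field.
  by lra.
have p0 : p = 0 by nra.
have q0 : q = 0 by nra.
by rewrite p0 q0.
Qed.

End PositiveDefinite.

Section TraceKernel.
Variables (R : realType) (G : topGroupType) (u : G -> R[i]).
Hypothesis ut : traces u.

Let upd : positive_definite u. Proof. by case: ut. Qed.
Let u1 : u 1%g = 1. Proof. by case: ut. Qed.

Lemma trace_kernel_subgroup : subgroup (trace_kernel u).
Proof.
split; first exact: u1.
- by move=> x y /= ux uy; rewrite /trace_kernel/= (posdef_mul_kernel upd u1).
- move=> x /= ux; rewrite /trace_kernel/= (posdef_inv upd u1) ux.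
  by congr (_ +i* _)%C; rewrite oppr0.
Qed.

Lemma trace_conj x y : u (x ^ y)%g = u x.
Proof.
have [_ _ _ utr] := ut.
by rewrite conjgE utr -mulgA mulgV mulg1.
Qed.

Definition trace_kernel_normal : normalSubgroup G :=
  @NormalSubgroup G (trace_kernel u) trace_kernel_subgroup
    (fun x y ux => etrans (trace_conj x y) ux).

Local Notation Q := (quotient_group trace_kernel_normal).
Local Open Scope quotient_scope.

(** The trace induced on the quotient; [quotient_traceE] shows that the choice of
    representatives is immaterial. *)
Definition quotient_trace (a : Q) : R[i] := u (repr a).

Lemma quotient_traceE x : quotient_trace (\pi_Q x) = u x.
Proof.
have /quot_eqP/= h : \pi_Q (repr (\pi_Q x)) = \pi_Q x by rewrite reprK.
have [_ _ _ utr] := ut.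
rewrite /quotient_trace -[in RHS](mulVKg (repr (\pi_Q x)) x).
by rewrite [in RHS]utr (posdef_mul_kernel upd u1).
Qed.

Lemma quotient_traces : traces quotient_trace.
Proof.
have [uc _ _ utr] := ut; split.
- apply/(@quotient_continuous G {eq_quot coset_equiv trace_kernel_normal} R[i]^o).
  rewrite (_ : _ \o _ = u)//.
  by apply/funext => x; exact: quotient_traceE.
- move=> n c s.
  have := upd c (fun i => repr (s i)); congr (0 <= _).
  apply: eq_bigr => i _; apply: eq_bigr => j _; congr (_ * _).
  rewrite -quotient_traceE; congr quotient_trace.
  have e : ((s i)^-1 * s j)%g = quot_mul (quot_inv (s i)) (s j) by [].
  rewrite e -[in RHS](reprK (s i)) -[in RHS](reprK (s j)).
  by rewrite (@quot_invE G) (@quot_mulE G).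
- by rewrite -u1 -quotient_traceE.
- move=> a b; have [x ->] := quot_pi_surj a; have [y ->] := quot_pi_surj b.
  have e z t : (\pi_Q z * \pi_Q t)%g = \pi_Q (z * t)%g by exact: quot_mulE.
  by rewrite !e !quotient_traceE utr.
Qed.

Lemma quotient_trace_faithful a : quotient_trace a = 1 -> a = 1%g.
Proof.
have [x ->] := quot_pi_surj a; rewrite quotient_traceE => ux.
by apply/esym/quot_eqP; rewrite invg1 mul1g.
Qed.

End TraceKernel.

(** * Compactly generated groups with a faithful trace are SIN *)

Section SINCriterion.
Variable G : topGroupType.

Lemma translate_continuous (a : G) : continuous (fun x : G => a * x)%g.
Proof.
move=> x; apply: (@continuous_comp _ _ _ (fun x => (a, x))
  (fun p : G * G => p.1 * p.2)%g); last exact: mulg_continuous.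
by apply: cvg_pair => /=; [exact: cvg_cst|exact: cvg_id].
Qed.

Lemma conjg_continuous : continuous (fun p : G * G => p.2 ^ p.1)%g.
Proof.
move=> [k x] /=; apply: (@continuous_comp _ _ _ (fun p : G * G => (p.1^-1, p.2 * p.1))%g
  (fun p : G * G => p.1 * p.2)%g); last exact: mulg_continuous.
apply: cvg_pair => /=.
- apply: (cvg_comp (fun p : G * G => p.1) (fun x : G => x^-1%g)); first exact: cvg_fst.
  exact: invg_continuous.
- apply: (cvg_comp (G := nbhs (x, k)) (fun p : G * G => (p.2, p.1))
      (fun p : G * G => p.1 * p.2)%g).
    by apply: cvg_pair => /=; [exact: cvg_snd|exact: cvg_fst].
  exact: (@mulg_continuous G (x, k)).
Qed.

Lemma locally_compact1 : locally_compact [set: G] ->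
  exists2 A : set G, nbhs 1%g A & compact A.
Proof.
move=> /(_ 1%g I) [A nA [cA _]]; exists A => //.
by move: nA; rewrite withinET.
Qed.

(** The elements [k] such that [k] and [k^-1] both conjugate [V] into itself form
    a subgroup. *)
Lemma generated_invariant (K V : set G) : smallest (@subgroup G) K = [set: G] ->
  (forall k x, K k -> V x -> V (x ^ k)%g /\ V (x ^ k^-1)%g) ->
  forall x y, V x -> V (x ^ y)%g.
Proof.
move=> gK hK.
pose S := [set k : G | forall x, V x -> V (x ^ k)%g /\ V (x ^ k^-1)%g].
have sS : subgroup S.
  split.
  - by move=> x Vx; rewrite invg1 conjg1.
  - move=> k l Sk Sl x Vx; rewrite invgM !conjgM; split.
      by apply: (Sl _ _).1; apply: (Sk _ _).1.
    by apply: (Sk _ _).2; apply: (Sl _ _).2.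
  - by move=> k Sk x Vx; rewrite invgK; have [] := Sk x Vx.
move=> x y Vx.
have : [set: G] y by [].
rewrite -gK => /(_ S) Sy; apply: (proj1 (Sy _ _ Vx)).
by split => // k Kk z Vz; exact: hK.
Qed.

(** For fixed [a], the continuous function [x |-> u (a^-1 * x)] takes the value 1
    at [a] only. *)
Lemma faithful_trace_hausdorff (R : realType) (u : G -> R[i]) :
  traces u -> (forall x, u x = 1 -> x = 1%g) -> hausdorff_space G.
Proof.
move=> [uc _ u1 _] uf a b clab.
suff : u (a^-1 * b)%g = 1 by move/uf/mulg1_eq; rewrite invgK.
have vc : continuous (fun x => u (a^-1 * x)%g : R[i]^o).
  move=> x; apply: continuous_comp; first exact: translate_continuous.
  exact: uc.
apply/esym/(@norm_hausdorff _ R[i]^o) => X Y nX nY.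
have := clab _ _ (vc a X _) (vc b Y nY); rewrite /= mulVg u1.
by move=> /(_ nX) [z [Xz Yz]]; exists (u (a^-1 * z)%g).
Qed.

(** Compact generation allows invariance under conjugation to be tested on a
    compact set, where the single function [u] bounds how far conjugation can
    move points close to 1. *)
Lemma faithful_trace_SIN (R : realType) (u : G -> R[i]) :
  locally_compact [set: G] -> compactly_generated G ->
  traces u -> (forall x, u x = 1 -> x = 1%g) -> SIN G.
Proof.
move=> lG [K cK gK] ut uf.
have [uc _ u1 _] := ut.
have hG := faithful_trace_hausdorff ut uf.
split; first by split.
move=> U nU.
have [A nA cA] := locally_compact1 lG.
pose K' := K `|` (fun x => x^-1%g) @` K.
have cK' : compact K'.
  apply: compactU => //; apply: continuous_compact => //.
  by apply: continuous_subspaceT => x; exact: invg_continuous.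
pose O := interior (A `&` U).
pose C := (fun p : G * G => p.2 ^ p.1)%g @` (K' `*` A) `&` ~` O.
have cC : compact C.
  apply: compact_closedI; last by apply: open_closedC; exact: open_interior.
  apply: continuous_compact; last exact: compact_setX.
  by apply: continuous_subspaceT; exact: conjg_continuous.
have cuC : closed ((u : G -> R[i]^o) @` C).
  apply: compact_closed; first exact: norm_hausdorff.
  by apply: continuous_compact => //; exact: continuous_subspaceT.
have nO : O 1%g by exact: filterI.
(* The values of u to avoid are those on C, the compact set of conjugates that
   have left O. *)
pose B : set R[i]^o := ~` ((u : G -> R[i]^o) @` C).
have nB : nbhs (1 : R[i]^o) B.
  apply: open_nbhs_nbhs; split; first exact: closed_openC.
  by move=> [c [_ nOc]] /uf c1; apply: nOc; rewrite c1.
exists ((u @^-1` B) `&` (A `&` U)); split.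
- apply: filterI; last exact: filterI.
  by apply: uc; rewrite u1.
- by move=> x [_ []].
- have conjK' k x : K' k -> (u @^-1` B `&` (A `&` U)) x ->
      (u @^-1` B `&` (A `&` U)) (x ^ k)%g.
    move=> K'k [Bx [Ax Ux]].
    have Bxk : B (u (x ^ k)%g) by rewrite (trace_conj ut).
    split => //; apply: interior_subset.
    apply: contrapT => nO'; apply: Bxk; exists (x ^ k)%g => //; split => //.
    by exists (k, x).
  apply: (generated_invariant gK) => k x Kk Vx.
  by split; apply: conjK' => //; [left|right; exists k].
Qed.

End SINCriterion.

(** * Topology of quotient groups *)

Section QuotientTopology.
Variables (G : topGroupType) (N : normalSubgroup G).
Local Notation Q := (quotient_group N).
Local Open Scope quotient_scope.

Lemma quotient_piM (x y : G) : \pi_Q (x * y)%g = (\pi_Q x * \pi_Q y)%g.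
Proof. by apply/esym; exact: quot_mulE. Qed.

Lemma quotient_piV (x : G) : \pi_Q x^-1%g = (\pi_Q x)^-1%g.
Proof. by apply/esym; exact: quot_invE. Qed.

Lemma quotient_compactly_generated :
  compactly_generated G -> compactly_generated Q.
Proof.
move=> [K cK gK]; exists ((\pi_Q : G -> Q) @` K).
  apply: continuous_compact => //; apply: continuous_subspaceT.
  exact: quot_pi_continuous.
apply/seteqP; split => // a _ S [[S1 SM SV] KS].
have [x ->] := quot_pi_surj a.
pose S' := (\pi_Q : G -> Q) @^-1` S.
have : [set: G] x by [].
rewrite -gK => /(_ S') S'x; apply: S'x; split.
  split; first exact: S1.
  - move=> y z Sy Sz; suff : S (\pi_Q (y * z)%g) by [].
    by rewrite quotient_piM; exact: SM.
  - move=> y Sy; suff : S (\pi_Q y^-1%g) by [].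
    by rewrite quotient_piV; exact: SV.
by move=> y Ky; apply: KS; exists y.
Qed.

Lemma quotient_locally_compact : hausdorff_space Q ->
  locally_compact [set: G] -> locally_compact [set: Q].
Proof.
move=> hQ lG a _; have [x ->] := quot_pi_surj a.
have [A nA [cA clA]] := lG x I.
have cpA : compact ((\pi_Q : G -> Q) @` A).
  apply: continuous_compact => //; apply: continuous_subspaceT.
  exact: quot_pi_continuous.
exists ((\pi_Q : G -> Q) @` A); last by split; [|exact: compact_closed].
rewrite withinET; move: nA; rewrite withinET nbhsE => -[U [oU Ux] UA].
rewrite nbhsE; exists ((\pi_Q : G -> Q) @` U); last exact: image_subset.
by split; [exact: quot_pi_open|exists x].
Qed.

End QuotientTopology.

(** * Conjugation-invariant bump functions *)

Section InvariantNeighbourhoods.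
Variable H : topGroupType.

Definition invariant (V : set H) := forall x y, V x -> V (x ^ y)%g.

Definition small_invariant_nbhds := forall U : set H, nbhs 1%g U ->
  exists V : set H, [/\ nbhs 1%g V, V `<=` U & invariant V].

Lemma nbhs1_mul (U : set H) : nbhs 1%g U ->
  exists2 V : set H, nbhs 1%g V & forall x y, V x -> V y -> U (x * y)%g.
Proof.
move=> nU; have := @mulg_continuous H (1%g, 1%g) U.
rewrite /= mulg1 => /(_ nU) [[A B] [/= nA nB] AB].
exists (A `&` B); first exact: filterI.
by move=> x y [Ax _] [_ By]; exact: (AB (x, y)).
Qed.

Lemma nbhs1_inv (U : set H) : nbhs 1%g U -> nbhs 1%g [set x | U x^-1%g].
Proof. by move=> nU; apply: invg_continuous; rewrite invg1. Qed.

Hypothesis sinH : small_invariant_nbhds.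

Lemma invariant_cube_root (U : set H) : nbhs 1%g U ->
  exists V : set H, [/\ nbhs 1%g V, invariant V &
    forall x y z, V x -> V y -> V z -> U (x * y * z)%g].
Proof.
move=> /nbhs1_mul[A nA AU]; have [B nB BA] := nbhs1_mul nA.
have [V [nV VAB Vi]] := sinH (filterI nA nB).
exists V; split=> // x y z /VAB[_ Bx] /VAB[_ By] /VAB[Az _].
by apply: AU => //; exact: BA.
Qed.

Lemma cube_root_sequence (U : set H) : nbhs 1%g U ->
  exists V : nat -> set H, [/\ V 0%N `<=` U, forall n, nbhs 1%g (V n),
    forall n, invariant (V n) &
    forall n x y z, V n.+1 x -> V n.+1 y -> V n.+1 z -> V n (x * y * z)%g].
Proof.
move=> nU.
have /choice[r rP] (A : set H) : exists B, nbhs 1%g A -> [/\ nbhs 1%g B, invariant B &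
    forall x y z, B x -> B y -> B z -> A (x * y * z)%g].
  have [/invariant_cube_root[B hB]|nA] := pselect (nbhs 1%g A); first by exists B.
  by exists setT.
pose V n := iter n.+1 r U.
have nV n : nbhs 1%g (iter n r U) by elim: n => //= n /rP[].
exists V; split.
- move=> x; have [n0 _ h] := rP _ (nV 0%N) => Vx.
  by have := h x 1%g 1%g Vx (nbhs_singleton n0) (nbhs_singleton n0); rewrite !mulg1.
- by move=> n; exact: nV.
- by move=> n; have [] := rP _ (nV n).
- by move=> n; have [] := rP _ (nV n.+1).
Qed.

End InvariantNeighbourhoods.

(** A chain for [x] writes [x] as a product of elements of the sets [V n], where a
    factor from [V n] weighs [2^-n].  The infimum of the weights of the chains for
    [x] is a length function; the bump is 1 minus this length, truncated at 0,
    which also gives a value to those [x] that have no chain. *)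
Section Chains.
Variables (R : realType) (H : topGroupType) (V : nat -> set H).
Hypotheses (V1 : forall n, V n 1%g)
  (V3 : forall n x y z, V n.+1 x -> V n.+1 y -> V n.+1 z -> V n (x * y * z)%g).
Implicit Type l : seq (nat * H).

Definition chain l := forall p, p \in l -> V p.1 p.2.
Definition weight l : R := \sum_(p <- l) 2^-1 ^+ p.1.
Definition chain_end l : H := (\prod_(p <- l) p.2)%g.

Lemma weight_ge0 l : 0 <= weight l.
Proof. by apply: sumr_ge0 => p _; rewrite exprn_ge0// invr_ge0. Qed.

Lemma chain_cat l1 l2 : chain (l1 ++ l2) <-> chain l1 /\ chain l2.
Proof.
split=> [h|[h1 h2] p]; last by rewrite mem_cat => /orP[/h1|/h2].
by split=> p pl; apply: h; rewrite mem_cat pl ?orbT.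
Qed.

Lemma chain1 p : chain [:: p] <-> V p.1 p.2.
Proof.
by split=> [h|h q]; [apply: h; rewrite inE|rewrite inE => /eqP->].
Qed.

Lemma V_le m n x : (m <= n)%N -> V n x -> V m x.
Proof.
move=> /subnK <-; elim: (n - m)%N x => //= k IH x Vx; apply: IH.
by have := V3 Vx (V1 _) (V1 _); rewrite !mulg1.
Qed.

(** The factor at which the accumulated weight first exceeds [t]. *)
Lemma split_chain l (t : R) : 0 <= t -> t < weight l ->
  exists l1 p l2, [/\ l = l1 ++ p :: l2, weight l1 <= t &
    t < weight l1 + 2^-1 ^+ p.1].
Proof.
elim: l t => [|q l IH] t t0; first by rewrite /weight big_nil ltNge t0.
rewrite /weight big_cons -/(weight l) => tl.
have [tq|qt] := ltP t (2^-1 ^+ q.1).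
  by exists [::], q, l; rewrite /weight big_nil add0r.
have [||l1 [p [l2 [-> h1 h2]]]] := IH (t - 2^-1 ^+ q.1).
- by rewrite subr_ge0.
- by rewrite ltrBlDl.
- exists (q :: l1), p, l2; rewrite /weight big_cons -/(weight l1); split => //; lra.
Qed.

(** Cut the chain at the factor that crosses half of the weight.  Both remaining
    parts weigh at most half, hence lie in [V m.+1] by induction on the length,
    and the middle factor is alone lighter than [2^-m], so it lies in [V m.+1]
    too; three elements of [V m.+1] multiply into [V m]. *)
Lemma chain_end_in m l : chain l -> weight l < 2^-1 ^+ m -> V m (chain_end l).
Proof.
have [k] := ubnP (size l); elim: k l m => // k IH l m; rewrite ltnS => lk cl wl.
have [l0|] := eqVneq l [::]; first by rewrite l0 /chain_end big_nil.
move=> ln0.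
have wpos : 0 < weight l.
  case: l ln0 {lk cl wl} => // p l _; rewrite /weight big_cons -/(weight l).
  by rewrite ltr_pwDl ?weight_ge0// exprn_gt0// invr_gt0.
have [||l1 [p [l2 [el h1 h2]]]] := @split_chain l (weight l / 2); [lra|lra|].
have wE : weight l = weight l1 + 2^-1 ^+ p.1 + weight l2.
  by rewrite el /weight big_cat big_cons /= addrA.
have [w10 w20] := (weight_ge0 l1, weight_ge0 l2).
have hm : 2^-1 ^+ m.+1 = 2^-1 ^+ m / 2 :> R by rewrite exprSr.
have [cl1 cpl2] : chain l1 /\ chain (p :: l2) by apply/chain_cat; rewrite -el.
have [/chain1 cp cl2] : chain [:: p] /\ chain l2 by apply/chain_cat.
have pm : (m.+1 <= p.1)%N.
  rewrite ltnNge; apply/negP => pm.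
  have : 2^-1 ^+ m <= 2^-1 ^+ p.1 :> R.
    by apply: ler_wiXn2l => //; lra.
  lra.
have -> : chain_end l = (chain_end l1 * p.2 * chain_end l2)%g.
  by rewrite el /chain_end big_cat big_cons /= mulgA.
move: lk; rewrite el size_cat /= => lk.
apply: V3; last 1 first.
- apply: IH => //; first by apply: leq_trans lk; rewrite addnS ltnS leq_addl.
  by lra.
- apply: IH => //; first by apply: leq_trans lk; rewrite addnS ltnS leq_addr.
  by lra.
- exact: V_le cp.
Qed.

Hypothesis V_invariant : forall n, invariant (V n).

(** Adjoining the value 0 performs the truncation. *)
Definition bump_values x : set R :=
  [set r | r = 0 \/ exists l, [/\ chain l, chain_end l = x & r = 1 - weight l]].
Definition bump x : R := sup (bump_values x).

Lemma bump_ubound x : ubound (bump_values x) 1.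
Proof.
by move=> r [->//|[l [_ _ ->]]]; have := weight_ge0 l; lra.
Qed.

Lemma bump_values_sup x : has_sup (bump_values x).
Proof. by split; [exists 0; left|exists 1; exact: bump_ubound]. Qed.

Lemma bump_ge0 x : 0 <= bump x.
Proof. by apply: (ub_le_sup (bump_values_sup x).2); left. Qed.

Lemma bump_le1 x : bump x <= 1.
Proof. by apply: ge_sup; [exact: (bump_values_sup x).1|exact: bump_ubound]. Qed.

Lemma bump1 : bump 1%g = 1.
Proof.
apply/eqP; rewrite eq_le bump_le1 /=.
apply: (ub_le_sup (bump_values_sup _).2); right; exists [::].
by rewrite /chain_end /weight !big_nil subr0; split => // p [].
Qed.

Lemma bump_support x : bump x != 0 -> V 0%N x.
Proof.
move=> fx; have fx0 : 0 < bump x by rewrite lt_neqAle eq_sym fx bump_ge0.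
have [r [->|[l [cl <- ->]]] h] := sup_adherent fx0 (bump_values_sup x).
  by move: h; rewrite subrr ltxx.
by apply: chain_end_in => //; move: h; rewrite subrr; rewrite expr0; lra.
Qed.

(** A chain for [x] extends by the factor [v] to a chain for [x * v]. *)
Lemma bump_mulr n x v : V n v -> bump x - 2^-1 ^+ n <= bump (x * v)%g.
Proof.
move=> Vv; rewrite lerBlDr; apply: ge_sup; first exact: (bump_values_sup x).1.
have n0 : 0 <= 2^-1 ^+ n :> R by rewrite exprn_ge0// invr_ge0.
move=> r [->|[l [cl <- ->]]]; first by rewrite addr_ge0// bump_ge0.
suff : 1 - (weight l + 2^-1 ^+ n) <= bump (chain_end l * v)%g by lra.
apply: (ub_le_sup (bump_values_sup _).2); right; exists (l ++ [:: (n, v)]).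
rewrite /weight /chain_end !big_cat !big_seq1; split => //.
by apply/chain_cat; split => //; apply/chain1.
Qed.

(** Conjugating every factor of a chain keeps its weight, as each [V n] is
    invariant. *)
Lemma bump_conj x y : bump (x ^ y)%g = bump x.
Proof.
suff h z t : bump z <= bump (z ^ t)%g.
  by apply/eqP; rewrite eq_le h andbT -[in leRHS](conjgK y x).
apply: ge_sup; first exact: (bump_values_sup z).1.
move=> r [->|[l [cl <- ->]]]; first exact: bump_ge0.
apply: (ub_le_sup (bump_values_sup _).2); right.
exists [seq (p.1, (p.2 ^ t)%g) | p <- l]; split.
- by move=> p /mapP[q /cl Vq ->]; exact: V_invariant.
- rewrite /chain_end; elim: l {cl} => [|p l IH]; first by rewrite !big_nil conj1g.
  by rewrite /= !big_cons IH conjMg.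
- by rewrite /weight big_map.
Qed.

End Chains.

Section Bump.
Variables (R : realType) (H : topGroupType).

(** Uniform continuity for the left uniform structure of the group: a small
    displacement is a multiplication on the right by an element close to 1. *)
Definition unif_cont (g : H -> R) := forall e : R, 0 < e ->
  \forall v \near (1%g : H), forall x, `|g (x * v)%g - g x| <= e.

Lemma invariant_bump (U : set H) : small_invariant_nbhds H -> nbhs 1%g U ->
  exists f : H -> R, [/\ forall x, 0 <= f x <= 1, f 1%g = 1,
    forall x, f x != 0 -> U x, forall x y, f (x ^ y)%g = f x & unif_cont f].
Proof.
move=> sinH /(cube_root_sequence sinH) [V [V0U nV Vi V3]].
have V1 n : V n 1%g by exact: nbhs_singleton.
exists (bump R V); split.
- by move=> x; rewrite bump_ge0 bump_le1.
- exact: bump1.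
- by move=> x /(bump_support V1 V3)/V0U.
- by move=> x y; exact: bump_conj.
- move=> e e0.
  have [n ne] : exists n, 2^-1 ^+ n < e.
    have : `|2^-1 : R| < 1 by rewrite ger0_norm ?invr_ge0// invf_lt1 ?ltr1n.
    move=> /cvg_expr/cvgrPdist_lt/(_ e e0)[n _ /(_ n (leqnn n))] /=.
    rewrite sub0r normrN normrX ger0_norm ?invr_ge0// => h; by exists n.
  near=> v => x.
  have Vv : V n v by near: v; exact: nV.
  have VvV : V n v^-1%g by near: v; apply: nbhs1_inv; exact: nV.
  rewrite ler_norml.
  have := bump_mulr R x Vv; have := bump_mulr R (x * v)%g VvV.
  rewrite mulgK; lra.
Unshelve. all: by end_near.
Qed.

End Bump.

(** * Covering numbers *)

Section CompactSupport.
Variables (R : realType) (H : topGroupType).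
Implicit Types (g h : H -> R) (K W : set H).

(** The functions that finitely many translates of any neighbourhood of 1 can
    cover.  No continuity is asked, so that indicators of compact sets belong to
    the class. *)
Definition compactly_dominated g :=
  exists K M, [/\ compact K, 0 <= M & forall x, g x <= M * \1_K x].

Definition ltranslate (a : H) g := fun x => g (a^-1 * x)%g.

Lemma compactly_dominated_le g h : (forall x, g x <= h x) ->
  compactly_dominated h -> compactly_dominated g.
Proof.
by move=> gh [K [M [cK M0 hM]]]; exists K, M; split=> // x; exact: le_trans (hM x).
Qed.

Lemma compactly_dominatedD g h : compactly_dominated g -> compactly_dominated h ->
  compactly_dominated (fun x => g x + h x).
Proof.
move=> [K [M [cK M0 gM]]] [L [M' [cL M'0 hM]]].
exists (K `|` L), (M + M'); split; [exact: compactU|exact: addr_ge0|move=> x].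
rewrite mulrDl; apply: lerD; [apply: le_trans (gM x) _|apply: le_trans (hM x) _].
- apply: ler_wpM2l => //; rewrite !indicE ler_nat in_setU.
  by case: (x \in K).
- apply: ler_wpM2l => //; rewrite !indicE ler_nat in_setU.
  by case: (x \in L); rewrite ?orbT.
Qed.

Lemma compactly_dominatedZ c g : 0 <= c -> compactly_dominated g ->
  compactly_dominated (fun x => c * g x).
Proof.
move=> c0 [K [M [cK M0 gM]]]; exists K, (c * M); split => //; first exact: mulr_ge0.
by move=> x; rewrite -mulrA; exact: ler_wpM2l.
Qed.

Lemma compactly_dominated_ltranslate a g : compactly_dominated g ->
  compactly_dominated (ltranslate a g).
Proof.
move=> [K [M [cK M0 gM]]]; exists ((fun x => a * x)%g @` K), M; split => //.
  apply: continuous_compact => //; apply: continuous_subspaceT.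
  exact: translate_continuous.
move=> x; apply: (le_trans (gM _)); apply: ler_wpM2l => //.
rewrite !indicE ler_nat; case: (boolP (_ \in K)) => //; rewrite inE => Kx.
by rewrite lt0b inE; exists (a^-1 * x)%g => //; rewrite mulVKg.
Qed.

(** The finite lists, directed by inclusion, form a filter along which
    compactness yields a list serving all points of [K] at once. *)
Lemma compact_translates K W : compact K -> nbhs 1%g W ->
  exists s : seq H, forall x, K x -> exists2 a, a \in s & W (a^-1 * x)%g.
Proof.
move=> /compact_near_coveringP cK nW.
pose F : set (set (seq H)) :=
  [set P | exists s0 : seq H, forall s : seq H, {subset s0 <= s} -> P s].
have FF : Filter F.
  split; first by exists [::].
  - move=> P Q [s sP] [t tQ]; exists (s ++ t) => r str; split.
      by apply: sP => a sa; apply: str; rewrite mem_cat sa.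
    by apply: tQ => a ta; apply: str; rewrite mem_cat ta orbT.
  - by move=> P Q PQ [s sP]; exists s => t st; apply/PQ/sP.
have [|s0 hs0] := cK _ F (fun (s : seq H) x => exists2 a, a \in s & W (a^-1 * x)%g) FF.
  move=> x Kx; exists ([set y | W (x^-1 * y)%g], [set s : seq H | x \in s]).
    split => /=; last by exists [:: x] => s; apply; rewrite inE.
    by apply: translate_continuous; rewrite mulVg.
  by move=> [y s] /= [Wy xs]; exists x.
by exists s0; exact: hs0.
Qed.

End CompactSupport.

Section CoveringNumbers.
Variables (R : realType) (H : topGroupType).
Implicit Types (g h : H -> R) (W : set H) (l : seq (R * H)).

(** A list of pairs [(c, a)] stands for the combination of the indicators of the
    translates [a * W] with coefficients [c].  The covering number of [g] is
    Weil's [(g : W)], the infimum of the total coefficients of the combinations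
    above [g]. *)
Definition step W l x : R := \sum_(p <- l) p.1 * \1_W (p.2^-1 * x)%g.
Definition cost l : R := \sum_(p <- l) p.1.
Definition covers W g l :=
  (forall p, p \in l -> 0 <= p.1) /\ forall x, g x <= step W l x.
Definition covering_number W g : R := inf [set cost l | l in covers W g].

Local Notation cov := covering_number.

Lemma cost_ge0 W g l : covers W g l -> 0 <= cost l.
Proof. by move=> [l0 _]; rewrite /cost big_seq; apply: sumr_ge0 => p /l0. Qed.

Lemma covers_exists W g : nbhs 1%g W -> compactly_dominated g ->
  exists l, covers W g l.
Proof.
move=> nW [K [M [cK M0 gM]]]; have [s sP] := compact_translates cK nW.
exists [seq (M, a) | a <- s]; split; first by move=> p /mapP[a _ ->].
move=> x; apply: le_trans (gM x) _; rewrite /step big_map /= -mulr_sumr.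
apply: ler_wpM2l => //.
have s0 : 0 <= \sum_(a <- s) (\1_W (a^-1 * x)%g : R).
  exact: sumr_ge0.
rewrite indicE; case: (boolP (x \in K)) => // /[!inE] /sP[a sa Wa].
rewrite (perm_big _ (perm_to_rem sa)) big_cons/= indicE mem_set//= lerDl.
exact: sumr_ge0.
Qed.

Lemma covering_number_le W g l : covers W g l -> cov W g <= cost l.
Proof.
move=> cl; apply: ge_inf; last by exists l.
by exists 0 => _ [m cm <-]; exact: cost_ge0 cm.
Qed.

Lemma le_covering_number W g c : nbhs 1%g W -> compactly_dominated g ->
  (forall l, covers W g l -> c <= cost l) -> c <= cov W g.
Proof.
move=> nW cg h; apply: lb_le_inf; last by move=> _ [l cl <-]; exact: h.
by have [l cl] := covers_exists nW cg; exists (cost l), l.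
Qed.

Section FixedNeighbourhood.
Variable W : set H.
Hypotheses (nW : nbhs 1%g W) (iW : invariant W).

Lemma covering_number_ge0 g : compactly_dominated g -> 0 <= cov W g.
Proof. by move=> cg; apply: le_covering_number => // l; exact: cost_ge0. Qed.

Lemma covering_number_mono g h : compactly_dominated h ->
  (forall x, g x <= h x) -> cov W g <= cov W h.
Proof.
move=> ch gh; apply: le_covering_number => // l [l0 hl].
by apply: covering_number_le; split=> // x; exact: le_trans (hl x).
Qed.

Lemma covering_numberD g h : compactly_dominated g -> compactly_dominated h ->
  cov W (fun x => g x + h x) <= cov W g + cov W h.
Proof.
move=> cg ch; rewrite -lerBlDr; apply: le_covering_number => // l [l0 gl].
rewrite lerBlDr addrC -lerBlDr; apply: le_covering_number => // m [m0 hm].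
rewrite lerBlDr addrC.
have -> : cost l + cost m = cost (l ++ m) by rewrite /cost big_cat.
apply: covering_number_le; split.
  by move=> p; rewrite mem_cat => /orP[/l0|/m0].
by move=> x; rewrite /step big_cat /=; exact: lerD.
Qed.

Lemma covering_numberZ c g : 0 <= c -> compactly_dominated g ->
  cov W (fun x => c * g x) <= c * cov W g.
Proof.
move=> c0 cg.
have cl l : covers W g l -> cov W (fun x => c * g x) <= c * cost l.
  move=> [l0 gl]; have -> : c * cost l = cost [seq (c * p.1, p.2) | p <- l].
    by rewrite /cost big_map mulr_sumr.
  apply: covering_number_le; split.
    by move=> p /mapP[q /l0 q0 ->]; exact: mulr_ge0.
  move=> x; rewrite /step big_map /=; under eq_bigr do rewrite -mulrA.
  by rewrite -mulr_sumr; exact: ler_wpM2l.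
have [c_eq0|cn0] := eqVneq c 0.
  have [l /cl] := covers_exists nW cg.
  by rewrite c_eq0 !mul0r.
have cp : 0 < c by rewrite lt_neqAle eq_sym cn0.
rewrite -ler_pdivrMl//; apply: le_covering_number => // l /cl.
by rewrite ler_pdivrMl.
Qed.

Lemma covering_number_ltranslate a g : compactly_dominated g ->
  cov W (ltranslate a g) <= cov W g.
Proof.
move=> cg; apply: le_covering_number => // l [l0 gl].
have -> : cost l = cost [seq (p.1, a * p.2)%g | p <- l] by rewrite /cost big_map.
apply: covering_number_le; split; first by move=> p /mapP[q /l0 q0 ->].
move=> x; apply: le_trans (gl _) _; rewrite /step big_map /=.
by apply: ler_sum => p _; rewrite invgM mulgA.
Qed.

(** Conjugation carries the translate [a * W] to a translate of the same [W],
    because [W] is invariant. *)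
Lemma covering_number_conj y g : compactly_dominated g ->
  cov W (fun x => g (x ^ y)%g) <= cov W g.
Proof.
move=> cg; apply: le_covering_number => // l [l0 gl].
have -> : cost l = cost [seq (p.1, p.2 ^ y^-1)%g | p <- l] by rewrite /cost big_map.
apply: covering_number_le; split; first by move=> p /mapP[q /l0 q0 ->].
move=> x; apply: le_trans (gl _) _; rewrite /step big_map /=.
apply: ler_sum => p _; rewrite le_eqVlt; apply/orP; left; apply/eqP; congr (_ * _).
rewrite !indicE; congr ((nat_of_bool _)%:R).
have -> : (p.2^-1 * x ^ y = ((p.2 ^ y^-1)^-1 * x) ^ y)%g.
  by rewrite conjMg conjVg conjgKV.
apply/idP/idP => /[!inE]; last exact: iW.
by move=> /(iW y^-1%g); rewrite conjgK.
Qed.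

Lemma le1_covering_number g : compactly_dominated g -> g 1%g = 1 ->
  1 <= cov W g.
Proof.
move=> cg g1; apply: le_covering_number => // l [l0 gl].
rewrite -g1; apply: le_trans (gl _) _; rewrite /step /cost !big_seq.
apply: ler_sum => p /l0 p0.
by rewrite -[leRHS]mulr1; apply: ler_wpM2l.
Qed.

(** Each translate of [A] in a combination can be replaced by the same translate
    of [F], which the sets [W] cover at the cost of [F]. *)
Lemma covering_number_step (A : set H) (F : H -> R) l :
  (forall p, p \in l -> 0 <= p.1) -> compactly_dominated F ->
  (forall x, \1_A x <= F x) ->
  compactly_dominated (step A l) /\ cov W (step A l) <= cost l * cov W F.
Proof.
move=> l0 cF AF; elim: l l0 => [|p l IH] l0.
  have c0 : compactly_dominated (step A [::]).
    exists set0, 0; split => // [|x]; first exact: compact0.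
    by rewrite /step big_nil mul0r.
  split=> //; rewrite /cost big_nil mul0r.
  have -> : 0 = cost [::] by rewrite /cost big_nil.
  by apply: covering_number_le; split=> // x; rewrite /step !big_nil.
have [|c1 h1] := IH; first by move=> q ql; apply: l0; rewrite inE ql orbT.
have p0 : 0 <= p.1 by apply: l0; rewrite inE eqxx.
have cp : compactly_dominated (fun x => p.1 * ltranslate p.2 F x).
  by apply: compactly_dominatedZ => //; exact: compactly_dominated_ltranslate.
have cS := compactly_dominatedD cp c1.
have lS x : step A (p :: l) x <= p.1 * ltranslate p.2 F x + step A l x.
  by rewrite /step big_cons lerD2r; exact: ler_wpM2l.
split; first exact: compactly_dominated_le cS.
apply: le_trans (covering_number_mono cS lS) _.
apply: le_trans (covering_numberD cp c1) _.
rewrite /cost big_cons mulrDl lerD//.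
apply: le_trans (covering_numberZ p0 (compactly_dominated_ltranslate p.2 cF)) _.
by apply: ler_wpM2l => //; exact: covering_number_ltranslate.
Qed.

End FixedNeighbourhood.

(** The comparison [(g : W) <= (g : A) (2 F : W)] with [A] the neighbourhood of 1
    on which [F] is at least [1 / 2].  The constant is independent of [W], which
    keeps the ratios of covering numbers bounded while [W] shrinks. *)
Lemma covering_number_compare g (F : H -> R) : compactly_dominated g ->
  compactly_dominated F -> (forall x, 0 <= F x) -> F 1%g = 1 -> unif_cont F ->
  exists2 C, 0 <= C &
    forall W, nbhs 1%g W -> cov W g <= C * cov W F.
Proof.
move=> cg cF F0 F1 uF.
pose A := [set x | 2^-1 <= F x].
have nA : nbhs 1%g A.
  have h2 : 0 < 2^-1 :> R by lra.
  near=> v; have /(_ 1%g) : forall x, `|F (x * v)%g - F x| <= 2^-1 by near: v; exact: uF.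
  by rewrite mul1g F1 ler_norml /A /=; lra.
have [l [l0 gl]] := covers_exists nA cg.
exists (cost l * 2); first by apply: mulr_ge0 => //; exact: cost_ge0 (conj l0 gl).
move=> W nW.
have c2F : compactly_dominated (fun x => 2 * F x) by exact: compactly_dominatedZ.
have AF x : \1_A x <= 2 * F x.
  rewrite indicE; case: (boolP (x \in A)) => [/set_mem h|_] /=.
    by move: h; rewrite /A/=; lra.
  exact: mulr_ge0.
have [cs hs] := covering_number_step nW l0 c2F AF.
apply: le_trans (covering_number_mono nW cs gl) _; apply: le_trans hs _.
rewrite -mulrA; apply: ler_wpM2l; first exact: cost_ge0 (conj l0 gl).
exact: covering_numberZ.
Unshelve. all: by end_near.
Qed.

End CoveringNumbers.

(** * Asymptotic additivity of covering numbers *)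

Section TestFunctions.
Variables (R : realType) (H : topGroupType).
Implicit Types (g h : H -> R) (W : set H).

Local Notation cov := covering_number.

(** The class on which the integral will be additive; nonnegative
    continuous functions of compact support are among them. *)
Definition test_function g :=
  [/\ forall x, 0 <= g x, compactly_dominated g & unif_cont g].

Lemma test_functionD g h : test_function g -> test_function h ->
  test_function (fun x => g x + h x).
Proof.
move=> [g0 cg ug] [h0 ch uh]; split.
- by move=> x; exact: addr_ge0.
- exact: compactly_dominatedD.
- move=> e e0; have e20 : 0 < e / 2 by lra.
  near=> v => x; rewrite opprD addrACA; apply: le_trans (ler_normD _ _) _.
  have : `|g (x * v)%g - g x| <= e / 2 by move: (x); near: v; exact: ug.
  have : `|h (x * v)%g - h x| <= e / 2 by move: (x); near: v; exact: uh.
  by lra.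
Unshelve. all: by end_near.
Qed.

Lemma test_functionZ c g : 0 <= c -> test_function g ->
  test_function (fun x => c * g x).
Proof.
move=> c0 [g0 cg ug]; split.
- by move=> x; exact: mulr_ge0.
- exact: compactly_dominatedZ.
- move=> e e0; have ec0 : 0 < e / (c + 1) by rewrite divr_gt0//; lra.
  near=> v => x; rewrite -mulrBr normrM ger0_norm//.
  have h : `|g (x * v)%g - g x| <= e / (c + 1) by move: (x); near: v; exact: ug.
  apply: le_trans (ler_wpM2l c0 h) _.
  rewrite mulrA ler_pdivrMr; last lra.
  by rewrite mulrC; apply: ler_wpM2l; lra.
Unshelve. all: by end_near.
Qed.

Lemma test_function_ltranslate a g : test_function g ->
  test_function (ltranslate a g).
Proof.
move=> [g0 cg ug]; split.
- by move=> x; exact: g0.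
- exact: compactly_dominated_ltranslate.
- move=> e e0; near=> v => x; rewrite /ltranslate mulgA.
  by move: (a^-1 * x)%g; near: v; exact: ug.
Unshelve. all: by end_near.
Qed.

Lemma test_function_bounded g : test_function g ->
  exists2 M, 0 <= M & forall x, g x <= M.
Proof.
move=> [_ [K [M [_ M0 gM]]] _]; exists M => // x; apply: le_trans (gM x) _.
by rewrite -[leRHS]mulr1; apply: ler_wpM2l.
Qed.

Lemma test_functionM g h : test_function g -> test_function h ->
  test_function (fun x => g x * h x).
Proof.
move=> tg th; have [M M0 gM] := test_function_bounded tg.
have [N N0 hN] := test_function_bounded th.
have [[g0 cg ug] [h0 ch uh]] := (tg, th); split.
- by move=> x; exact: mulr_ge0.
- apply: (compactly_dominated_le _ (compactly_dominatedZ N0 cg)) => x.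
  by rewrite mulrC; exact: ler_wpM2r.
- move=> e e0; have d0 : 0 < e / (M + N + 1) by rewrite divr_gt0//; lra.
  near=> v => x.
  have -> : g (x * v)%g * h (x * v)%g - g x * h x =
    (g (x * v)%g - g x) * h (x * v)%g + g x * (h (x * v)%g - h x) by ring.
  apply: le_trans (ler_normD _ _) _; rewrite !normrM.
  rewrite (ger0_norm (g0 _)) (ger0_norm (h0 _)).
  have hg : `|g (x * v)%g - g x| <= e / (M + N + 1) by move: (x); near: v; exact: ug.
  have hh : `|h (x * v)%g - h x| <= e / (M + N + 1) by move: (x); near: v; exact: uh.
  have h1 : `|g (x * v)%g - g x| * h (x * v)%g <= e / (M + N + 1) * N by apply: ler_pM.
  have h2 : g x * `|h (x * v)%g - h x| <= M * (e / (M + N + 1)) by apply: ler_pM.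
  apply: le_trans (lerD h1 h2) _.
  rewrite [M * _]mulrC -mulrDr mulrAC ler_pdivrMr; last lra.
  by apply: ler_wpM2l; lra.
Unshelve. all: by end_near.
Qed.

(** The quotient [g / F] varies little between two points where [g] and [F] vary
    little and [F] stays above [d]. *)
Lemma weight_perturbation (d t F F' g g' : R) : 0 < d -> 0 <= g' -> g' <= F' ->
  d <= F -> d <= F' -> `|g - g'| <= d * t -> `|F - F'| <= 2 * (d * t) ->
  g / F <= g' / F' + 3 * t.
Proof.
move=> d0 g'0 g'F' dF dF' hg.
have dt0 : 0 <= d * t by exact: le_trans hg.
have t0 : 0 <= t by rewrite -(pmulr_rge0 _ d0).
move: hg => /ler_normlP[_ gg] /ler_normlP[FF _].
have F0 : 0 < F by lra.
have F'0 : 0 < F' by lra.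
rewrite ler_pdivrMr// mulrDl.
have : g' <= g' / F' * F + 2 * (d * t).
  have q0 : 0 <= g' / F' by apply: divr_ge0 => //; exact: ltW.
  have q1 : g' / F' <= 1 by rewrite ler_pdivrMr// mul1r.
  have {1}-> : g' = g' / F' * F' by rewrite mulfVK// gt_eqF.
  have : g' / F' * (F' - F) <= 2 * (d * t) by nra.
  by rewrite mulrBr; lra.
have : d * t <= t * F by nra.
by lra.
Qed.

(** Weil's argument.  Let [F] be [g1 + g2] plus a small multiple of an indicator,
    which keeps [F] away from 0 near the supports.  A cheap covering of [F] by
    translates of a small [W] splits into coverings of [g1] and [g2]: the
    coefficient at [a] is shared in the proportions [g1 a / F a] and
    [g2 a / F a], which add up to at most 1 and are nearly constant on
    [a * W]. *)
Lemma covering_number_superadditive g1 g2 (K A : set H) (eta : R) :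
  test_function g1 -> test_function g2 -> compact K -> compact A ->
  nbhs 1%g A -> (forall x, g1 x != 0 -> K x) -> (forall x, g2 x != 0 -> K x) ->
  0 < eta ->
  exists2 V, nbhs 1%g V & forall W, nbhs 1%g W -> W `<=` V ->
    cov W g1 + cov W g2 <= (1 + eta) * (cov W (fun x => g1 x + g2 x) +
      eta * cov W (\1_((fun p : H * H => p.1 * p.2)%g @` (K `*` A)))).
Proof.
move=> [g10 c1 u1] [g20 c2 u2] cK cA nA g1K g2K eta0.
set KA := _ @` _.
have cKA : compact KA.
  apply: continuous_compact; last exact: compact_setX.
  by apply: continuous_subspaceT; exact: mulg_continuous.
have dKA : compactly_dominated (\1_KA : H -> R).
  by exists KA, 1; split => // x; rewrite mul1r.
pose F x := g1 x + g2 x + eta * \1_KA x.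
have d12 := compactly_dominatedD c1 c2.
have dZ := compactly_dominatedZ (ltW eta0) dKA.
have dF : compactly_dominated F by exact: compactly_dominatedD.
(* Each share is enlarged by 3 * t to absorb its variation on a translate of W;
   the two enlargements add up to eta. *)
pose t := eta / 6.
have t0 : 0 < t by rewrite /t; lra.
pose V := [set v : H | [/\ A v^-1%g, forall x, `|g1 (x * v)%g - g1 x| <= eta * t &
   forall x, `|g2 (x * v)%g - g2 x| <= eta * t]].
have nV : nbhs 1%g V.
  have et0 : 0 < eta * t by exact: mulr_gt0.
  near=> v; split.
  - by near: v; exact: nbhs1_inv.
  - by near: v; exact: u1.
  - by near: v; exact: u2.
exists V => // W nW WV.
have F1 x : 0 <= (\1_KA x : R) by [].
have gF1 x : 0 <= g1 x <= F x.
  rewrite g10/= /F -addrA lerDl; apply: addr_ge0 => //; exact: mulr_ge0 (ltW _) _.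
have gF2 x : 0 <= g2 x <= F x.
  rewrite g20/= /F addrAC lerDr; apply: addr_ge0 => //; exact: mulr_ge0 (ltW _) _.
have FKA x : KA x -> eta <= F x.
  move=> KAx; rewrite /F indicE mem_set// mulr1 lerDr; exact: addr_ge0.
(* Reweighting by the enlarged proportion of g in F turns a covering of F into
   a covering of g. *)
have reweight g l : covers W F l -> (forall x, 0 <= g x <= F x) ->
    (forall x, g x != 0 -> K x) ->
    (forall v x, V v -> `|g (x * v)%g - g x| <= eta * t) ->
    cov W g <= \sum_(p <- l) p.1 * (g p.2 / F p.2 + 3 * t).
  move=> [l0 Fl] gF gK gV.
  have -> : \sum_(p <- l) p.1 * (g p.2 / F p.2 + 3 * t) =
      cost [seq (p.1 * (g p.2 / F p.2 + 3 * t), p.2) | p <- l].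
    by rewrite /cost big_map.
  have q0 s : 0 <= g s / F s + 3 * t.
    have /andP[gs0 gsF] := gF s.
    by apply: addr_ge0; [apply: divr_ge0 => //; exact: le_trans gsF|lra].
  apply: covering_number_le; split.
    by move=> p /mapP[q /l0 ql ->]; exact: mulr_ge0.
  move=> x; rewrite /step big_map /= big_seq.
  have [gx|gx] := eqVneq (g x) 0.
    rewrite gx; apply: sumr_ge0 => p /l0 p0.
    by apply: mulr_ge0 => //; exact: mulr_ge0.
  have Kx := gK x gx.
  have KAx : KA x by exists (x, 1%g); rewrite /= ?mulg1//; split => //; exact: nbhs_singleton.
  have eF := FKA x KAx.
  have Fx0 : 0 < F x by exact: lt_le_trans eF.
  have -> : g x = F x * (g x / F x) by rewrite mulrC mulfVK// gt_eqF.
  have gFx0 : 0 <= g x / F x.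
    by have /andP[? _] := gF x; apply: divr_ge0 => //; exact: ltW.
  apply: le_trans (ler_wpM2r gFx0 (Fl x)) _.
  rewrite /step mulr_suml big_seq; apply: ler_sum => p /l0 p0.
  rewrite -!mulrA; apply: ler_wpM2l => //.
  rewrite indicE; case: (boolP (_ \in W)) => [/set_mem Wp|_]; last by rewrite !mul0r mulr0.
  rewrite mul1r mulr1.
  have [Av V1 V2] := WV _ Wp.
  have KAp : KA p.2.
    (* A contains the inverses of W, so the centre of the translate is in K * A. *)
    exists (x, (p.2^-1 * x)^-1)%g; first by split.
    by rewrite /= invgM invgK mulgA mulgV mul1g.
  have xE : x = (p.2 * (p.2^-1 * x))%g by rewrite mulVKg.
  have h1 := V1 p.2; have h2 := V2 p.2; have hg := gV _ p.2 (WV _ Wp).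
  rewrite -xE in h1 h2 hg.
  have /andP[gp0 gpF] := gF p.2.
  apply: (weight_perturbation eta0) => //; first exact: FKA.
  rewrite /F !indicE !mem_set// opprD addrACA subrr addr0 opprD addrACA.
  by apply: le_trans (ler_normD _ _) _; lra.
have hF : cov W F <= cov W (fun x => g1 x + g2 x) + eta * cov W (\1_KA : H -> R).
  apply: le_trans (covering_numberD nW d12 dZ) _; rewrite lerD2l.
  exact: covering_numberZ (ltW _) _.
apply: le_trans (_ : (1 + eta) * cov W F <= _); last by apply: ler_wpM2l => //; lra.
rewrite -ler_pdivrMl; last lra.
apply: le_covering_number => // l cl; rewrite ler_pdivrMl; last lra.
have r1 := reweight g1 l cl gF1 g1K (fun v x Vv => let: And3 _ h _ := Vv in h x).
have r2 := reweight g2 l cl gF2 g2K (fun v x Vv => let: And3 _ _ h := Vv in h x).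
apply: le_trans (lerD r1 r2) _.
rewrite -big_split /= /cost mulr_sumr !big_seq; apply: ler_sum => p pl.
rewrite -mulrDr mulrC; apply: ler_wpM2r; first exact: cl.1.
rewrite addrACA -mulrDl.
have q1 : (g1 p.2 + g2 p.2) / F p.2 <= 1.
  have [->|Fn0] := eqVneq (F p.2) 0; first by rewrite invr0 mulr0.
  have Fp : 0 < F p.2 by rewrite lt_neqAle eq_sym Fn0; have /andP[/le_trans h /h] := gF1 p.2.
  by rewrite ler_pdivrMr// mul1r /F lerDl mulr_ge0// ltW.
by rewrite /t; lra.
Unshelve. all: by end_near.
Qed.
End TestFunctions.

(** * The Haar integral of a SIN group *)

Lemma ultrafilter_bounded_cvg (R : realType) (T : Type) (F : set_system T)
    (r : T -> R) (a b : R) : UltraFilter F ->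
  (\forall t \near F, a <= r t <= b) -> exists p : R, r t @[t --> F] --> p.
Proof.
move=> UF rab; have Fab : (r @ F) `[a, b]%classic.
  by apply: filterS rab => t rt; rewrite /= in_itv.
have [p [_ clp]] := @segment_compact R a b _ _ Fab; exists p => A nA.
have [//|nFA] := in_ultra_setVsetC (r @^-1` A) UF.
by have [x []] := clp (~` A) A nFA nA.
Qed.

Section HaarIntegral.
Variables (R : realType) (H : topGroupType).
Local Notation cov := (@covering_number R H).

(** Eventually along this filter means: for all sufficiently small invariant
    neighbourhoods of 1. *)
Definition shrinking : set_system (set H) := [set P | exists2 V : set H, nbhs 1%g V &
  forall W, nbhs 1%g W -> invariant W -> W `<=` V -> P W].

Lemma shrinking_proper : small_invariant_nbhds H -> ProperFilter shrinking.
Proof.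
move=> sinH; apply: Build_ProperFilter_ex.
  move=> P [V nV VP]; have [W [nW WV iW]] := sinH V nV.
  by exists W; exact: VP.
split; first by exists setT => //; exact: filterT.
- move=> P Q [V nV VP] [V' nV' VQ]; exists (V `&` V'); first exact: filterI.
  by move=> W nW iW WV; split; [apply: VP|apply: VQ] => // x /WV[].
- by move=> P Q PQ [V nV VP]; exists V => // W nW iW WV; apply/PQ/VP.
Qed.

(** Invariance under left translations and under conjugations amounts to
    two-sided invariance.  Conjugates of test functions are required to be test
    functions in [haar_conj] since their uniform continuity depends on the
    group. *)
Record haar_integral (I : (H -> R) -> R) : Prop := HaarIntegral {
  haar_le : forall g h, test_function g -> test_function h ->
    (forall x, g x <= h x) -> I g <= I h;
  haarD : forall g h, test_function g -> test_function h ->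
    I (fun x => g x + h x) = I g + I h;
  haarZ : forall c g, 0 <= c -> test_function g -> I (fun x => c * g x) = c * I g;
  haar_ltranslate : forall a g, test_function g -> I (ltranslate a g) = I g;
  haar_conj : forall y g, test_function g -> test_function (fun x => g (x ^ y)%g) ->
    I (fun x => g (x ^ y)%g) = I g
}.

Lemma test_function_supports (g h : H -> R) :
  test_function g -> test_function h -> exists K : set H, [/\ compact K,
    forall x, g x != 0 -> K x & forall x, h x != 0 -> K x].
Proof.
move=> [g0 [K [M [cK M0 gM]]] _] [h0 [L [N [cL N0 hN]]] _].
have supp (k : H -> R) (C : set H) m : (forall x, 0 <= k x) ->
    (forall x, k x <= m * \1_C x) -> forall x, k x != 0 -> C x.
  move=> k0 km x; apply: contraNP => nC.
  by rewrite eq_le k0 andbT; have := km x; rewrite indicE memNset// mulr0.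
exists (K `|` L); split; first exact: compactU.
- by move=> x /(supp g K M g0 gM); left.
- by move=> x /(supp h L N h0 hN); right.
Qed.

(** The ratios [(g : W) / (f : W)] stay in a bounded interval, so they converge
    along an ultrafilter of shrinking [W], for all [g] simultaneously.  Relations
    between covering numbers become relations between the limits. *)
Lemma haar_exists (f : H -> R) : small_invariant_nbhds H ->
  locally_compact [set: H] -> test_function f -> f 1%g = 1 ->
  exists2 I, haar_integral I & I f = 1.
Proof.
move=> sinH lcH [f0 cf uf] f1.
have [U [UU sU]] := ultraFilterLemma (shrinking_proper sinH).
have near_small P : (forall W, nbhs 1%g W -> invariant W -> P W) -> U P.
  by move=> h; apply: sU; exists setT => [|W nW iW _]; [exact: filterT|exact: h].
pose r g W := cov W g / cov W f.
have covf W : nbhs 1%g W -> 0 < cov W f.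
  by move=> nW; apply: lt_le_trans (le1_covering_number nW cf f1).
have /choice[I IP] g : exists p : R, compactly_dominated g -> r g W @[W --> U] --> p.
  have [cg|ncg] := pselect (compactly_dominated g); last by exists 0.
  have [C C0 hC] := covering_number_compare cg cf f0 f1 uf.
  have [|p rp] := @ultrafilter_bounded_cvg R _ U (r g) 0 C UU; last by exists p.
  apply: near_small => W nW iW /=; have f_gt0 := covf W nW.
  rewrite divr_ge0 ?(ltW f_gt0) ?covering_number_ge0//=.
  by rewrite ler_pdivrMr//; exact: hC.
(* All the inequalities with a single covering number on each side pass to the
   limit in the same way. *)
have I_le g h c : compactly_dominated g -> compactly_dominated h ->
    (forall W, nbhs 1%g W -> invariant W -> cov W g <= c * cov W h) -> I g <= c * I h.
  move=> cg ch gh; rewrite -subr_ge0.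
  apply: cvgr_to_ge (cvgB (cvgMl_tmp (a := c) (IP h ch)) (IP g cg)) _.
  apply: near_small => W nW iW /=; rewrite /r !fctE mulrA -mulrBl divr_ge0 ?(ltW (covf W nW))//.
  by rewrite subr_ge0; exact: gh.
have I_mono g h : compactly_dominated h -> (forall x, g x <= h x) -> I g <= I h.
  move=> ch gh; rewrite -[leRHS]mul1r; apply: I_le => //.
    exact: compactly_dominated_le ch.
  by move=> W nW iW; rewrite mul1r; exact: covering_number_mono.
have I_ge0 g : compactly_dominated g -> 0 <= I g.
  move=> cg; apply: cvgr_to_ge (IP g cg) _; apply: near_small => W nW iW.
  by rewrite divr_ge0 ?covering_number_ge0.
have I_subadd g h : compactly_dominated g -> compactly_dominated h ->
    I (fun x => g x + h x) <= I g + I h.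
  move=> cg ch; rewrite -subr_ge0.
  apply: cvgr_to_ge (cvgB (cvgD (IP g cg) (IP h ch)) (IP _ (compactly_dominatedD cg ch))) _.
  apply: near_small => W nW iW /=.
  rewrite /r !fctE -mulrDl -mulrBl divr_ge0 ?(ltW (covf W nW))// subr_ge0.
  exact: covering_numberD.
have I_Zle c g : 0 <= c -> compactly_dominated g -> I (fun x => c * g x) <= c * I g.
  move=> c0 cg; apply: I_le => //; first exact: compactly_dominatedZ.
  by move=> W nW iW; exact: covering_numberZ.
have I_tle a g : compactly_dominated g -> I (ltranslate a g) <= I g.
  move=> cg; rewrite -[leRHS]mul1r; apply: I_le => //.
    exact: compactly_dominated_ltranslate.
  by move=> W nW iW; rewrite mul1r; exact: covering_number_ltranslate.
have I_cle y g : compactly_dominated g -> compactly_dominated (fun x => g (x ^ y)%g) ->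
    I (fun x => g (x ^ y)%g) <= I g.
  move=> cg cgy; rewrite -[leRHS]mul1r; apply: I_le => //.
  by move=> W nW iW; rewrite mul1r; exact: covering_number_conj.
exists I; last first.
  apply: (@cvg_unique _ (@Rhausdorff R) (r f @ U)); first exact: IP.
  apply: cvg_near_cst; apply: near_small => W nW iW.
  by rewrite /r divff// gt_eqF// covf.
split.
- by move=> g h _ [_ ch _]; exact: I_mono.
- move=> g h tg th; have [[g0 cg ug] [h0 ch uh]] := (tg, th).
  apply/eqP; rewrite eq_le I_subadd//=.
  have [K [cK gK hK]] := test_function_supports tg th.
  have [A nA cA] := locally_compact1 lcH.
  set KA := (fun p : H * H => p.1 * p.2)%g @` (K `*` A).
  have cKA : compact KA.
    apply: continuous_compact; last exact: compact_setX.
    by apply: continuous_subspaceT; exact: mulg_continuous.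
  have dKA : compactly_dominated (\1_KA : H -> R).
    by exists KA, 1; split => // x; rewrite mul1r.
  set s := I (fun x => g x + h x); set j := I (\1_KA : H -> R).
  (* The superadditivity estimate in the limit, for a fixed error eta. *)
  have bound eta : 0 < eta -> I g + I h <= (1 + eta) * (s + eta * j).
    move=> eta0; rewrite -subr_ge0.
    have [V nV hV] := covering_number_superadditive tg th cK cA nA gK hK eta0.
    apply: cvgr_to_ge (cvgB (cvgMl_tmp (a := 1 + eta) (cvgD (IP _ (compactly_dominatedD cg ch))
      (cvgMl_tmp (a := eta) (IP _ dKA)))) (cvgD (IP g cg) (IP h ch))) _.
    apply: sU; exists V => // W nW iW WV /=.
    rewrite [X in 0 <= X](_ : _ = ((1 + eta) * (cov W (fun x => g x + h x) +
      eta * cov W \1_KA) - (cov W g + cov W h)) / cov W f); last by rewrite /r !fctE; ring.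
    by rewrite divr_ge0 ?(ltW (covf W nW))// subr_ge0; exact: hV.
  have s0 : 0 <= s by exact/I_ge0/compactly_dominatedD.
  have j0 : 0 <= j by exact: I_ge0.
  apply/ler_addgt0Pr => e e0.
  (* For eta <= 1 the error terms are at most eta * (s + 2 * j). *)
  pose eta := Num.min 1 (e / (s + 2 * j + 1)).
  have eta0 : 0 < eta by rewrite lt_min ltr01/= divr_gt0//; lra.
  have eta1 : eta <= 1 by rewrite ge_min lexx.
  have etae : eta * (s + 2 * j + 1) <= e.
    by rewrite -ler_pdivlMr; [rewrite /eta ge_min lexx orbT|lra].
  apply: le_trans (bound eta eta0) _.
  have : eta * eta * j <= eta * j by apply: ler_wpM2r => //; rewrite ler_piMr// ltW.
  by lra.
- move=> c g c0 [g0 cg ug]; apply/eqP; rewrite eq_le I_Zle//=.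
  have [->|cn0] := eqVneq c 0.
    by rewrite mul0r; apply: I_ge0; exact: compactly_dominatedZ.
  have cp : 0 < c by rewrite lt_neqAle eq_sym cn0.
  rewrite -ler_pdivlMl//.
  have := I_Zle c^-1 _ (ltW _) (compactly_dominatedZ c0 cg).
  rewrite invr_gt0 => /(_ cp); congr (I _ <= _).
  by apply/funext => x; rewrite mulKf.
- move=> a g [g0 cg ug]; apply/eqP; rewrite eq_le I_tle//=.
  have := I_tle a^-1%g _ (compactly_dominated_ltranslate a cg).
  congr (I _ <= _); apply/funext => x.
  by rewrite /ltranslate invgK mulKg.
- move=> y g [_ cg _] [_ cgy _]; apply/eqP; rewrite eq_le I_cle//=.
  have := I_cle y^-1%g _ cgy.
  have -> : (fun x => g ((x ^ y^-1) ^ y)%g) = g by apply/funext => x; rewrite conjgKV.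
  exact.
Qed.

End HaarIntegral.

(** For a real symmetric matrix, the Hermitian form at [c = a + 'i b] is the sum of
    the quadratic forms at [a] and at [b]: the cross terms cancel. *)
Lemma hermitian_form_ge0 (R : realType) (n : nat) (v : 'I_n -> 'I_n -> R)
    (c : 'I_n -> R[i]) : (forall i j, v i j = v j i) ->
  (forall a : 'I_n -> R, 0 <= \sum_(i < n) \sum_(j < n) a i * a j * v i j) ->
  0 <= \sum_(i < n) \sum_(j < n) conjc (c i) * c j * (v i j)%:C%C.
Proof.
move=> vC vpd.
pose a i := complex.Re (c i); pose b i := complex.Im (c i).
have ReD : {morph (@complex.Re R) : x y / x + y} by case=> [p q] [r s].
have ImD : {morph (@complex.Im R) : x y / x + y} by case=> [p q] [r s].
have Re0 : complex.Re (0 : R[i]) = 0 by [].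
have Im0 : complex.Im (0 : R[i]) = 0 by [].
rewrite lecE !(big_morph _ ImD Im0) !(big_morph _ ReD Re0).
under eq_bigr => i _.
  rewrite (big_morph _ ImD Im0).
  under eq_bigr => j _.
    have -> : complex.Im (conjc (c i) * c j * (v i j)%:C%C) =
        a i * b j * v i j - b i * a j * v i j.
      by rewrite /a /b; case: (c i) => p q; case: (c j) => r s /=; ring.
    over.
  rewrite sumrB; over.
rewrite sumrB [X in _ - X]exchange_big /=.
under [X in _ - X]eq_bigr do under eq_bigr do rewrite [b _ * _]mulrC vC.
rewrite subrr eqxx /=.
under eq_bigr => i _.
  rewrite (big_morph _ ReD Re0).
  under eq_bigr => j _.
    have -> : complex.Re (conjc (c i) * c j * (v i j)%:C%C) =
        a i * a j * v i j + b i * b j * v i j.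
      by rewrite /a /b; case: (c i) => p q; case: (c j) => r s /=; ring.
    over.
  rewrite big_split; over.
by rewrite big_split addr_ge0.
Qed.

(** * The autocorrelation of an invariant bump function is a trace *)

Section Autocorrelation.
Variables (R : realType) (H : topGroupType) (I : (H -> R) -> R) (f : H -> R).
Hypotheses (haarI : haar_integral I) (tf : test_function f)
  (f_conj : forall x y, f (x ^ y)%g = f x)
  (If : I (fun x => f x * f x) = 1).

Lemma haar_sum (T : Type) (r : seq T) (c : T -> R) (g : T -> H -> R) :
  (forall i, 0 <= c i) -> (forall i, test_function (g i)) ->
  test_function (fun x => \sum_(i <- r) c i * g i x) /\
  I (fun x => \sum_(i <- r) c i * g i x) = \sum_(i <- r) c i * I (g i).
Proof.
move=> c0 tg; elim: r => [|i r [tr IHr]].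
  have -> : (fun x : H => \sum_(i <- [::]) c i * g i x) = fun x => 0 * f x.
    by apply/funext => x; rewrite big_nil mul0r.
  by split; [exact: test_functionZ|rewrite haarZ// mul0r big_nil].
have -> : (fun x => \sum_(j <- i :: r) c j * g j x) =
    fun x => c i * g i x + \sum_(j <- r) c j * g j x.
  by apply/funext => x; rewrite big_cons.
have ti : test_function (fun x => c i * g i x) by exact: test_functionZ.
by split; [exact: test_functionD|rewrite haarD// haarZ// IHr big_cons].
Qed.

(** The convolution of [f] with its reflection. *)
Definition autocorrelation s := I (fun x => f x * ltranslate s f x).
Local Notation w := autocorrelation.

Let tfM s t : test_function (fun x => ltranslate s f x * ltranslate t f x).
Proof. by apply: test_functionM; exact: test_function_ltranslate. Qed.

Let ltranslate1 : ltranslate 1%g f = f.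
Proof. by apply/funext => x; rewrite /ltranslate invg1 mul1g. Qed.

Let tfw s : test_function (fun x => f x * ltranslate s f x).
Proof. by rewrite -{1}ltranslate1. Qed.

Lemma autocorrelation_gram a b :
  w (a^-1 * b)%g = I (fun x => ltranslate a f x * ltranslate b f x).
Proof.
rewrite /w -(haar_ltranslate haarI a (tfw _)); congr I; apply/funext => x.
by rewrite /ltranslate invgM invgK -mulgA mulVKg.
Qed.

Lemma autocorrelationV s : w s^-1%g = w s.
Proof.
rewrite -[s^-1%g]mulg1 autocorrelation_gram ltranslate1 /w.
by congr I; apply/funext => x; rewrite mulrC.
Qed.

Lemma autocorrelation1 : w 1%g = 1.
Proof. by rewrite /w ltranslate1. Qed.

(** As [f] is invariant, conjugating [s] amounts to conjugating the variable of
    integration. *)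
Lemma autocorrelation_conj s y : w (s ^ y)%g = w s.
Proof.
rewrite /w; have e : (fun x => f x * ltranslate s f x) =
    (fun x => (fun z => f z * ltranslate (s ^ y)%g f z) (x ^ y)%g).
  apply/funext => x; rewrite /ltranslate -conjVg -conjMg.
  by rewrite !f_conj.
rewrite e; apply/esym/(haar_conj haarI); first exact: tfw.
by rewrite -e; exact: tfw.
Qed.

Lemma autocorrelationC s t : w (s * t)%g = w (t * s)%g.
Proof. by rewrite -(autocorrelation_conj (s * t)%g s) conjgE mulgA mulKg. Qed.

(** The sum is the integral of the square of the combination of the translates of
    [f] with coefficients [a i].  The integral is additive on nonnegative
    functions only, so the products [a i * a j] are separated by sign and the two
    parts are compared through monotonicity. *)
Lemma autocorrelation_psd n (a : 'I_n -> R) (s : 'I_n -> H) :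
  0 <= \sum_(i < n) \sum_(j < n) a i * a j * w ((s i)^-1 * s j)%g.
Proof.
pose P (k : 'I_n * 'I_n) := Num.max (a k.1 * a k.2) 0.
pose N (k : 'I_n * 'I_n) := Num.max (- (a k.1 * a k.2)) 0.
pose g (k : 'I_n * 'I_n) x := ltranslate (s k.1) f x * ltranslate (s k.2) f x.
have PN k : a k.1 * a k.2 = P k - N k.
  by rewrite /P /N /Num.max; do 2 case: ifP => ?; lra.
have P0 k : 0 <= P k by rewrite le_max lexx orbT.
have N0 k : 0 <= N k by rewrite le_max lexx orbT.
have tg k : test_function (g k) by exact: tfM.
rewrite pair_big /=.
under eq_bigr => k _ do rewrite PN autocorrelation_gram mulrBl.
rewrite sumrB subr_ge0.
have [tP IP] := haar_sum (index_enum _) P0 tg.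
have [tN IN] := haar_sum (index_enum _) N0 tg.
rewrite -[leRHS]IP -[leLHS]IN; apply: (haar_le haarI) => // x.
rewrite -subr_ge0 -sumrB; under eq_bigr => k _ do rewrite -mulrBl -PN.
have -> : \sum_(k : 'I_n * 'I_n) a k.1 * a k.2 * g k x =
    (\sum_(i < n) a i * ltranslate (s i) f x) ^+ 2.
  rewrite expr2 mulr_suml; under [RHS]eq_bigr do rewrite mulr_sumr.
  by rewrite pair_big /=; apply: eq_bigr => k _; rewrite /g; ring.
exact: sqr_ge0.
Qed.

(** Uniform continuity controls displacements on the right, whereas [s] acts on
    the left; the two sides agree because [f (x * y) = f (y * x)]. *)
Lemma autocorrelation_continuity s e : 0 < e ->
  \forall t \near s, `|w s - w t| <= e.
Proof.
move=> e0; have [f0 _ uf] := tf.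
have If0 : 0 <= I f.
  have := haar_le haarI (test_functionZ (lexx 0) tf) tf.
  by rewrite haarZ// mul0r; apply => x; rewrite mul0r.
pose d := e / (I f + 1).
have d0 : 0 < d by rewrite divr_gt0//; lra.
have de : d * I f <= e.
  by rewrite /d mulrAC ler_pdivrMr; [apply: ler_wpM2l|]; lra.
have nd : \forall t \near s, forall x, `|f (x * (s * t^-1))%g - f x| <= d.
  have c : continuous (fun t : H => s * t^-1)%g.
    move=> t; apply: (@continuous_comp _ _ _ (fun t : H => t^-1%g)).
      exact: invg_continuous.
    exact: translate_continuous.
  have cs : (s * t^-1)%g @[t --> s] --> (1%g : H) by rewrite -[X in _ --> X](mulgV s); exact: c.
  exact: cs (uf _ d0).
have w_le a b : (forall x, ltranslate a f x <= ltranslate b f x + d) ->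
    w a <= w b + e.
  move=> ab; apply: le_trans (_ : w b + d * I f <= _); last by rewrite lerD2l.
  have td := test_functionZ (ltW d0) tf.
  rewrite -(haarZ haarI (ltW d0) tf) /w -(haarD haarI (tfw b) td).
  apply: (haar_le haarI) => //; first exact: test_functionD.
  by move=> x; rewrite [d * _]mulrC -mulrDr; exact: ler_wpM2l.
near=> t.
have ht x : `|ltranslate t f x - ltranslate s f x| <= d.
  have fC y z : f (y * z)%g = f (z * y)%g by rewrite -(f_conj (y * z)%g y) conjgE mulgA mulKg.
  rewrite /ltranslate !(fC _ x).
  have -> : (x * t^-1 = (x * s^-1) * (s * t^-1))%g by rewrite mulgA mulgVK.
  by move: (x * s^-1)%g; near: t.
have h1 : w s <= w t + e.
  by apply: w_le => x; have := ht x; rewrite ler_norml; lra.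
have h2 : w t <= w s + e.
  by apply: w_le => x; have := ht x; rewrite ler_norml; lra.
by rewrite ler_norml; lra.
Unshelve. all: by end_near.
Qed.

Lemma autocorrelation_trace : traces (fun s => (w s)%:C%C).
Proof.
split.
- move=> s; apply/cvgrPdist_lt => e; rewrite ltcE /= => /andP[/eqP ei e0].
  have e2 : 0 < complex.Re e / 2 by lra.
  near=> t; rewrite -rmorphB /= normc_def /= expr0n addr0 sqrtr_sqr.
  rewrite ltcE /= ei eqxx /=.
  apply: le_lt_trans (_ : complex.Re e / 2 < _); last lra.
  by near: t; exact: autocorrelation_continuity.
- move=> n c s; apply: hermitian_form_ge0; last first.
    by move=> a; exact: autocorrelation_psd.
  by move=> i j; rewrite -autocorrelationV invgM invgK.
- by rewrite autocorrelation1.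
- by move=> s t; rewrite autocorrelationC.
Unshelve. all: by end_near.
Qed.

End Autocorrelation.

Lemma SIN_trace_separates (R : realType) (H : topGroupType) (a : H) :
  SIN H -> a != 1%g -> exists2 u : H -> R[i], traces u & u a = 0.
Proof.
move=> [[hH lH] sH] a1.
have sinH : small_invariant_nbhds H by [].
have [A nA cA] := locally_compact1 lH.
have nU : nbhs 1%g [set z | z != a].
  apply: open_nbhs_nbhs; split; last by rewrite /= eq_sym.
  have -> : [set z : H | z != a] = ~` [set a].
    by apply/seteqP; split => z /=; [move/eqP|move/eqP].
  by apply: closed_openC; exact/accessible_closed_set1/hausdorff_accessible.
have [B nB BU] := nbhs1_mul nU.
(* If f did not vanish at x and at a^-1 * x, then a would be the product of x in
   B and of the inverse of a^-1 * x, also in B, but B * B avoids a. *)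
pose V := A `&` B `&` [set x | B x^-1%g].
have nV : nbhs 1%g V.
  by apply: filterI; [exact: filterI|exact: nbhs1_inv].
have [f [f01 f1 fV fJ uf]] := @invariant_bump R H V sinH nV.
have tf : test_function f.
  split=> //; first by move=> x; case/andP: (f01 x).
  exists A, 1; split => // x; rewrite mul1r indicE.
  have [->//|/fV[[Ax _] _]] := eqVneq (f x) 0.
  by rewrite mem_set//; case/andP: (f01 x).
have ff1 : f 1%g * f 1%g = 1 by rewrite f1 mulr1.
have [I mI If] := haar_exists sinH lH (test_functionM tf tf) ff1.
exists (fun s => (autocorrelation I f s)%:C%C); first exact: autocorrelation_trace.
have -> // : autocorrelation I f a = 0.
rewrite /autocorrelation.
have -> : (fun x => f x * ltranslate a f x) = fun x => 0 * f x.
  apply/funext => x; rewrite mul0r /ltranslate; apply/eqP; rewrite mulf_eq0.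
  apply/negPn/negP; rewrite negb_or => /andP[/fV[[_ Bx] _] /fV[_ Bax]].
  by have := BU _ _ Bx Bax; rewrite /= invgM invgK mulgA mulgV mul1g eqxx.
by rewrite (haarZ mI)// mul0r.
Qed.

(** * The two kernels *)

Lemma N_Tr_sub_N_SIN (R : realType) (G : topGroupType) : N_Tr R G `<=` N_SIN G.
Proof.
move=> x xT N [clN sinN]; apply: contrapT => Nx.
pose p : G -> quotient_group N := \pi_(quotient_group N)%qT.
have px : p x != 1%g.
  apply/eqP => /esym/quot_eqP; rewrite invg1 mul1g; exact: Nx.
have [u [uc upd u1 uC] ux] := SIN_trace_separates R sinN px.
have pM y z : p (y * z)%g = (p y * p z)%g by exact: quotient_piM.
have pV y : p y^-1%g = (p y)^-1%g by exact: quotient_piV.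
have tup : traces (u \o p).
  split.
  - move=> y; apply: continuous_comp; first exact: quot_pi_continuous.
    exact: uc.
  - move=> n c s; have := upd n c (p \o s); congr (0 <= _).
    by apply: eq_bigr => i _; apply: eq_bigr => j _; rewrite /= pM pV.
  - exact: u1.
  - by move=> y z; rewrite /= !pM uC.
have := xT _ tup; rewrite /trace_kernel /= ux => /eqP.
by rewrite eq_sym oner_eq0.
Qed.

Lemma N_SIN_sub_N_Tr (R : realType) (G : topGroupType) :
  locally_compact [set: G] -> compactly_generated G -> N_SIN G `<=` N_Tr R G.
Proof.
move=> lG cG x xS u ut.
have qt := quotient_traces ut; have qf := quotient_trace_faithful (ut := ut).
apply: (xS (trace_kernel_normal ut)); split.
- have [uc _ _ _] := ut.
  apply: (proj1 (@continuous_closedP G R[i]^o u) uc [set 1]).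
  exact/accessible_closed_set1/hausdorff_accessible/norm_hausdorff.
- apply: (faithful_trace_SIN _ _ qt qf); last exact: quotient_compactly_generated.
  apply: quotient_locally_compact => //; exact: faithful_trace_hausdorff qt qf.
Qed.

Theorem corollary2p8 (R : realType) (G : topGroupType)
    (hG : lc_group G) (hcg : compactly_generated G) :
  N_Tr R G = N_SIN G.
Proof.
apply/seteqP; split; first exact: N_Tr_sub_N_SIN.
by apply: N_SIN_sub_N_Tr => //; case: hG.
Qed.
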